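(* Let $G$ be a finite connected $k$-regular simple graph of girth $g$ with exactly $d+1$ distinct eigenvalues. If $g\ge 2d-1$, then $G$ is a distance-regular graph of diameter $d$.
   Context: The eigenvalues of a finite graph are the eigenvalues of its adjacency matrix. The girth of a graph is the length of a shortest cycle. Let $d(x,y)$ denote the shortest path distance between vertices $x$ and $y$. A connected graph with vertex set $V$ is distance-regular if, for all non-negative integers $i,j,l$ and all $x,y\in V$ with $d(x,y)=l$, the number of vertices $z\in V$ with $d(x,z)=i$ and $d(z,y)=j$ depends only on $i,j,l$ and not on the choice of $x,y$. *)

(* Defs.v *)
From mathcomp Require Import all_boot all_order all_algebra.

Set Implicit Arguments.
Unset Strict Implicit.
Unset Printing Implicit Defensive.

Import GRing.Theory.

(* A simple graph on the vertex set T is an irreflexive symmetric e : rel T. *)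
Section Graph.

Variables (T : finType) (e : rel T).

Definition connected_graph : Prop :=
  0 < #|T| /\ forall x y : T, connect e x y.

Definition regular_graph (k : nat) : Prop :=
  forall x : T, #|[set y | e x y]| = k.

Definition has_walk (n : nat) (x y : T) : bool :=
  [exists p : n.-tuple T, path e x p && (last x p == y)].

(* The least length of a walk from x to y. A shortest walk has fewer than #|T|
   edges; #|T| is a default value when y is not reachable from x. *)
Definition dist (x y : T) : nat :=
  find (fun n => has_walk n x y) (iota 0 #|T|).

Definition diameter : nat := \max_(u : T * T) dist u.1 u.2.

Definition is_graph_cycle (c : seq T) : bool := (2 < size c) && ucycleb e c.

(* None encodes the infinite girth of an acyclic graph. *)
Definition is_girth (g : option nat) : Prop :=
  match g with
  | Some n => (exists2 c, is_graph_cycle c & size c = n) /\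
              (forall c, is_graph_cycle c -> n <= size c)
  | None => forall c, ~~ is_graph_cycle c
  end.

Definition distance_regular : Prop :=
  connected_graph /\
  exists p : nat -> nat -> nat -> nat,
    forall (i j l : nat) (x y : T), dist x y = l ->
      #|[set z | (dist x z == i) && (dist z y == j)]| = p i j l.

Definition adjacency (F : nzRingType) : 'M[F]_#|T| :=
  \matrix_(i, j) ((e (enum_val i) (enum_val j))%:R)%R.

Lemma has_walkP n x y :
  reflect (exists p, [/\ path e x p, last x p = y & size p = n])
          (has_walk n x y).
Proof.
apply: (iffP existsP) => [[p /andP[ep /eqP yE]]|[p [ep yE /eqP szp]]].
  by exists p; rewrite size_tuple.
by exists (Tuple szp); rewrite /= ep yE eqxx.
Qed.

Lemma distP x y : connect e x y ->
  has_walk (dist x y) x y /\ forall n, has_walk n x y -> dist x y <= n.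
Proof.
move=> /connectP[p0 ep0 yE].
have ltw n : has_walk n x y -> exists2 m, m < #|T| & has_walk m x y /\ m <= n.
  move=> /has_walkP[p [ep <- <-]].
  case/shortenP: ep => p' ep' up' sub_p'.
  exists (size p').
    by have := max_card (mem (x :: p')); rewrite (card_uniqP up').
  split; first by apply/has_walkP; exists p'.
  by apply: uniq_leq_size sub_p'; case/andP: up'.
have w0 : has_walk (size p0) x y by apply/has_walkP; exists p0; rewrite -yE.
have [m ltm [wm _]] := ltw _ w0.
have hasw : has (fun n => has_walk n x y) (iota 0 #|T|).
  by apply/hasP; exists m; rewrite ?mem_iota.
split.
  have := nth_find 0 hasw; rewrite nth_iota //.
  by move: hasw; rewrite has_find size_iota.
move=> n /ltw[i lti [wi le_in]]; apply: leq_trans le_in.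
rewrite leqNgt; apply/negP => lt_id; have := before_find 0 lt_id.
by rewrite nth_iota // wi.
Qed.

End Graph.

Definition girth_geq (g : option nat) (m : nat) : bool :=
  if g is Some n then m <= n else true.

Definition num_distinct_eigenvalues (F : fieldType) (m : nat) (A : 'M[F]_m)
    (n : nat) : Prop :=
  exists s : seq F, [/\ uniq s, size s = n & s =i eigenvalue A].

(* Main.v *)
Require Import Defs.
From mathcomp Require Import all_boot all_order all_algebra zify ring.

Set Implicit Arguments.
Unset Strict Implicit.
Unset Printing Implicit Defensive.

Import Order.TTheory GRing.Theory Num.Theory.

(** Let A be the adjacency matrix and let A_i be the 0/1 matrix of the pairs of
    vertices at distance i. The point is that every A_i is a polynomial of
    degree i in A, for i <= d.

    - For i < d this comes from the girth. Two distinct neighbors of x that are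
      both no farther from y than x is yield a cycle through x
      ([near_neighbor_uniq]). Since cycles have length at least 2d - 1, a vertex
      x at distance j from y, 0 < j < d, has exactly one neighbor at distance
      j - 1, and none at distance j if j < d - 1. Hence
      A A_(i+1) = A_(i+2) + (k - [i > 0]) A_i whenever i + 2 < d
      ([card_neighbors_at_dist]), which determines A_i recursively.
    - The matrix A is real symmetric, so its minimal polynomial has d + 1 simple
      roots, one of them k. Dividing by X - k leaves a polynomial of degree d
      whose value at A has rows and columns that are harmonic functions, hence
      constant: it is a nonzero multiple of the all-ones matrix J
      ([hoffman_polynomial]).
    - As J has degree d in A, no distance exceeds d. Therefore
      A_d = J - (A_0 + ... + A_(d-1)) is also a polynomial of degree d in A
      ([distance_poly]), and it is nonzero because the minimal polynomial has
      degree d + 1. So the diameter is d.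

    Modulo the minimal polynomial, every polynomial in A has degree at most d
    and is thus a linear combination of the A_i: its entries depend only on the
    distance ([horner_mx_dist]). Applied to A_i A_j, whose entries count the
    vertices at distances i and j from two given ones, this is
    distance-regularity. *)

(** * Distances, neighbors and short cycles *)

Section Distance.

Variables (T : finType) (e : rel T).
Hypotheses (e_irr : irreflexive e) (e_sym : symmetric e)
  (e_conn : forall x y, connect e x y).

Local Notation dist := (dist e).

Lemma dist_walk x p : path e x p -> dist x (last x p) <= size p.
Proof.
move=> ep; have [_ min_d] := distP (e_conn x (last x p)).
by apply: min_d; apply/has_walkP; exists p.
Qed.

Lemma geodesic x y :
  exists p, [/\ path e x p, last x p = y & size p = dist x y].
Proof. by apply/has_walkP; case: (distP (e_conn x y)). Qed.

Lemma dist_eq0 x y : (dist x y == 0) = (x == y).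
Proof.
apply/eqP/eqP => [d0|->]; last by have := @dist_walk y [::] isT; case: dist.
by have [[|z p] [_ /= yE szp]] := geodesic x y; rewrite // d0 in szp.
Qed.

Lemma dist_adj x y z : e x z -> dist x y <= (dist z y).+1.
Proof.
move=> exz; have [p [ep <- <-]] := geodesic z y.
by apply: (@dist_walk x (z :: p)); rewrite /= exz.
Qed.

Lemma closer_neighbor x y :
  0 < dist x y -> exists2 z, e x z & (dist z y).+1 = dist x y.
Proof.
have [[|z p] [/= ep yE szp]] := geodesic x y; first by rewrite -szp.
move: ep => /andP[exz ep] _; exists z => //.
by have := dist_walk ep; have := dist_adj y exz; rewrite yE -szp; lia.
Qed.

Lemma dist_eq1 x y : (dist x y == 1) = e x y.
Proof.
apply/eqP/idP => [d1|exy].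
  have [|z exz] := @closer_neighbor x y; rewrite d1 // => -[] /eqP.
  by rewrite dist_eq0 => /eqP <-.
apply/eqP; rewrite eqn_leq (@dist_walk x [:: y]) /= ?exy //.
by rewrite lt0n dist_eq0; apply: contraTneq exy => ->; rewrite e_irr.
Qed.

(** If x were on p after its start z, the rest of p would be a walk from x to y
    shorter than p. *)
Lemma far_geodesic_avoids x y z p :
  path e z p -> last z p = y -> size p <= dist x y -> z != x -> x \notin z :: p.
Proof.
move=> ep yE szp z_x; rewrite inE eq_sym (negPf z_x) /=.
apply/negP => /splitPr xp; case: xp ep yE szp => p1 p2.
rewrite cat_path last_cat size_cat /= => /and3P[_ _ /dist_walk] le_d yE.
by rewrite yE in le_d; lia.
Qed.

(** Erasing the loops of the walk leaves a simple path from z1 to z2, which x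
    closes into a cycle. *)
Lemma cycle_of_avoiding_walk x z1 z2 p :
    e x z1 -> e x z2 -> z1 != z2 ->
    path e z1 p -> last z1 p = z2 -> x \notin z1 :: p ->
  exists2 c, is_graph_cycle e c & size c <= (size p).+2.
Proof.
move=> ex1 ex2 z12 ep; case/shortenP: ep => q eq uq sub_qp z2E xp.
exists [:: x, z1 & q].
  rewrite /is_graph_cycle /ucycleb /cycle -cats1 [path _ _ _]/= ex1 cat_path eq.
  rewrite z2E /= e_sym ex2 /= in uq *; rewrite uq !andbT.
  apply/andP; split; first by case: (q) z2E z12 => //= ->; rewrite eqxx.
  by apply: contra xp; rewrite !inE => /orP[->//|/sub_qp ->]; rewrite orbT.
by rewrite /= !ltnS uniq_leq_size //; case/andP: uq.
Qed.

Section Girth.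

Variable m : nat.
Hypothesis long_cycles : forall c, is_graph_cycle e c -> m <= size c.

(** Geodesics from z1 and z2 to y avoid x; glued at y, they form a walk from z1
    to z2 that would close into a short cycle through x if z1 and z2 differed.
    *)
Lemma near_neighbor_uniq x y z1 z2 : e x z1 -> e x z2 ->
    dist z1 y <= dist x y -> dist z2 y <= dist x y ->
    dist z1 y + dist z2 y + 2 < m ->
  z1 = z2.
Proof.
move=> ex1 ex2 le1 le2 lt_m; apply/eqP; apply: contraLR lt_m => z12.
have nbr_neq z : e x z -> z != x by apply: contraTneq => ->; rewrite e_irr.
have [p1 [ep1 yE1 sz1]] := geodesic z1 y.
have [p2 [ep2 yE2 sz2]] := geodesic z2 y.
rewrite -sz1 in le1; rewrite -sz2 in le2.
have x_p1 := far_geodesic_avoids ep1 yE1 le1 (nbr_neq _ ex1).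
have x_p2 := far_geodesic_avoids ep2 yE2 le2 (nbr_neq _ ex2).
have := @cycle_of_avoiding_walk x z1 z2 (p1 ++ rev (belast z2 p2)) ex1 ex2 z12.
case.
- rewrite cat_path ep1 yE1 -yE2 rev_path.
  by rewrite (@eq_path _ _ e) // => u v; rewrite e_sym.
- rewrite last_cat yE1 -yE2; case: (p2) => //= u r.
  by rewrite rev_cons last_rcons.
- rewrite -cat_cons mem_cat mem_rev negb_or x_p1 /=.
  by apply: contra x_p2; apply: mem_belast.
move=> c /long_cycles le_m; rewrite size_cat size_rev size_belast sz1 sz2.
by move=> le_c; lia.
Qed.

(** A vertex x at distance j from y has a single neighbor closer to y if j > 0,
    and no neighbor at its own distance if j <= i + 1, so that all the others are
    at distance j + 1. This is the entrywise form of a three-term recurrence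
    between the distance matrices. The bound on m is set by the case j = i + 2,
    where two closer neighbors would give a cycle of length at most 2i + 4. *)
Lemma card_neighbors_at_dist k i x y :
    regular_graph e k -> i.*2 + 5 <= m ->
  #|[set z | e x z && (dist z y == i.+1)]|
    = (dist x y == i.+2) + (k - (0 < i)) * (dist x y == i).
Proof.
move=> e_reg lt_m; set N := [set z | _].
have inN z : (z \in N) = e x z && (dist z y == i.+1) by rewrite inE.
have nbrP z : e x z -> dist x y <= (dist z y).+1 /\ dist z y <= (dist x y).+1.
  by move=> exz; split; apply: dist_adj; rewrite // e_sym.
(* The closer neighbor of x is the only element of N. *)
have [dxy|d_neq2] := eqVneq (dist x y) i.+2.
  have [|z0 ez0 dz0] := @closer_neighbor x y; first by rewrite dxy.
  rewrite [_ == i](_ : _ = false); last by lia.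
  rewrite muln0 addn0 -[RHS](cards1 z0); congr #|pred_of_set _|.
  apply/setP => z; rewrite inN inE; apply/andP/eqP => [[ez /eqP dz]|->].
    by apply: (@near_neighbor_uniq x y); rewrite //; lia.
  by rewrite ez0; split=> //; apply/eqP; lia.
(* An element of N can only exist if x is itself at distance i + 1 from y, and
   then it competes with the closer neighbor of x. *)
have [dxy|d_neq0] := eqVneq (dist x y) i; last first.
  rewrite muln0; apply/eqP; rewrite cards_eq0; apply/eqP/setP => z.
  rewrite inN inE; apply/andP => -[ez /eqP dz]; have [le1 le2] := nbrP z ez.
  have dxy : dist x y = i.+1 by lia.
  have [|z0 ez0 dz0] := @closer_neighbor x y; first by rewrite dxy.
  suff: z = z0 by move=> zE; rewrite zE in dz; lia.
  by apply: (@near_neighbor_uniq x y); rewrite //; lia.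
(* Every neighbor of x is in N, except for the closer one if there is one. *)
rewrite muln1 add0n -(e_reg x).
have [i0|i_gt0] := posnP i.
  rewrite subn0; congr #|pred_of_set _|; apply/setP => z.
  rewrite inN inE; case ez: (e x z) => //=.
  have /eqP xy : x == y by rewrite -dist_eq0 dxy i0.
  by rewrite i0 dist_eq1 // -xy e_sym ez.
have [|z0 ez0 dz0] := @closer_neighbor x y; first by rewrite dxy.
rewrite (cardsD1 z0 [set z | e x z]) inE ez0 add1n subn1 /=.
congr #|pred_of_set _|; apply/setP => z; rewrite inN !inE.
case ez: (e x z); rewrite ?andbF ?andbT //=; have [le1 le2] := nbrP z ez.
apply/eqP/idP => [dz|z_z0]; first by apply/eqP => zE; rewrite zE in dz; lia.
apply/eqP; rewrite eqn_leq -{1}dxy le2 ltnNge; apply: contra z_z0 => le_i.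
by apply/eqP/(@near_neighbor_uniq x y); rewrite //; lia.
Qed.

End Girth.

End Distance.

(** * Symmetric matrices and harmonic functions *)

Local Open Scope ring_scope.

(** A real symmetric matrix is diagonalizable, so its minimal polynomial is the
    product of the X - x over its distinct eigenvalues x. *)
Lemma size_mxminpoly_symmetric (C : numClosedFieldType) n (A : 'M[C]_n.+1) m :
    A \is symmetricmx -> A \is a mxOver Num.real ->
    num_distinct_eigenvalues A m ->
  size (mxminpoly A) = m.+1.
Proof.
move=> A_sym A_real [s [us <- sE]].
have /orthomx_spectralP AE := symmetric_normalmx A_sym A_real.
have minE : mxminpoly A = \prod_(x <- undup [seq spectral_diag A 0 i |
                                          i <- enum 'I_n.+1]) ('X - x%:P).
  rewrite -mxminpoly_diag {1}AE -conjVmx ?spectral_unit //.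
  by rewrite mxminpoly_uconj // unitmx_inv spectral_unit.
rewrite minE size_prod_XsubC; congr _.+1; apply/perm_size/uniq_perm => //.
  exact: undup_uniq.
by move=> x; rewrite -root_prod_XsubC -minE sE; rewrite -eigenvalue_root_min.
Qed.

(** The Dirichlet energy of f, the sum of |f x - f y|^2 over adjacent x and y,
    expands to 2k |f|^2 - 2 <f, A f>, which vanishes because A f = k f. Hence f
    agrees at adjacent vertices. *)
Lemma harmonic_constant (C : numClosedFieldType) (T : finType) (e : rel T)
    k (f : T -> C) :
    symmetric e -> (forall x y, connect e x y) -> regular_graph e k ->
    (forall x, \sum_(y | e x y) f y = k%:R * f x) ->
  forall x y, f x = f y.
Proof.
move=> e_sym e_conn e_reg f_harm.
have sum_deg (h : T -> C) : \sum_x \sum_(y | e x y) h x = k%:R * \sum_x h x.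
  rewrite mulr_sumr; apply: eq_bigr => x _.
  by rewrite sumr_const -(e_reg x) mulr_natl cardsE.
have swap (h : T -> T -> C) :
    \sum_x \sum_(y | e x y) h x y = \sum_x \sum_(y | e x y) h y x.
  rewrite (exchange_big_dep xpredT) //=; apply: eq_bigr => x _.
  by apply: eq_bigl => y; rewrite e_sym.
have cross : \sum_x \sum_(y | e x y) (f x)^* * f y
    = k%:R * \sum_x (f x)^* * f x.
  rewrite mulr_sumr; apply: eq_bigr => x _.
  by rewrite -mulr_sumr f_harm mulrCA.
have energy0 : \sum_x \sum_(y | e x y) `|f x - f y| ^+ 2 = 0.
  pose D x := (f x)^* * f x; pose X x y := (f x)^* * f y.
  have sqE x y : `|f x - f y| ^+ 2 = (D x + D y) - (X x y + X y x).
    by rewrite normCK rmorphB /D /X; ring.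
  under eq_bigr => x _ do under eq_bigr => y _ do rewrite sqE.
  under eq_bigr => x _ do rewrite sumrB !big_split /=.
  rewrite sumrB !big_split /= sum_deg (swap (fun x y => D y)) sum_deg.
  by rewrite (swap (fun x y => X y x)) cross subrr.
have f_adj x y : e x y -> f x = f y.
  move=> exy; apply/eqP; rewrite -subr_eq0 -normr_eq0 -sqrf_eq0; apply/eqP.
  have /psumr_eq0P/(_ x isT) energy_x := energy0.
  have sq_ge0 u v : 0 <= `|f u - f v| ^+ 2 by rewrite exprn_ge0.
  have {}/psumr_eq0P :=
    energy_x (fun u _ => sumr_ge0 _ (fun v _ => sq_ge0 u v)).
  by apply.
move=> x y; have /connectP[p ep ->] := e_conn x y.
by elim: p x ep => //= z p IHp x /andP[/f_adj-> /IHp].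
Qed.

(** * Polynomials in the adjacency matrix *)

Section AdjacencyAlgebra.

Variables (C : numClosedFieldType) (T : finType) (e : rel T) (k n : nat).
(* The type of ev exhibits the number of vertices as a successor, which
   horner_mx needs in order to evaluate in a nonzero matrix ring. *)
Variables (ev : 'I_n.+1 -> T) (ev_bij : bijective ev).
Hypotheses (e_irr : irreflexive e) (e_sym : symmetric e).
Hypotheses (e_conn : forall x y, connect e x y) (e_reg : regular_graph e k).

Local Notation dist := (dist e).

Definition relation_mx (P : rel T) : 'M[C]_n.+1 :=
  \matrix_(a, b) (P (ev a) (ev b))%:R.

Local Notation A := (relation_mx e).
Local Notation distance_mx i := (relation_mx (fun x y => dist x y == i)).

Lemma relation_mx_mul (P Q : rel T) :
  relation_mx P *m relation_mx Q
    = \matrix_(a, b) #|[set z | P (ev a) z && Q z (ev b)]|%:R.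
Proof.
apply/matrixP => a b; rewrite !mxE -sum1_card natr_sum.
rewrite [RHS](reindex ev) /=; last exact: onW_bij.
rewrite [RHS]big_mkcond /=; apply: eq_bigr => c _.
by rewrite !mxE inE -natrM mulnb; case: (_ && _).
Qed.

(** The (x, y) entry of A^i counts the walks of length i from x to y, of which
    there are none if y is farther than i from x. *)
Lemma horner_mx_far (r : {poly C}) a b :
  (size r <= dist (ev a) (ev b))%N -> horner_mx A r a b = 0.
Proof.
move=> le_r.
have powA i c : (i < dist (ev c) (ev b))%N -> (A ^+ i) c b = 0.
  elim: i c => [|i IHi] c lt_i.
    rewrite expr0 mxE; case: eqP lt_i => // ->.
    by rewrite lt0n dist_eq0 // eqxx.
  rewrite exprS mxE big1 // => c' _; rewrite !mxE.
  case ecc': (e _ _); last by rewrite mul0r.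
  rewrite IHi ?mulr0 // -ltnS.
  exact: leq_trans lt_i (dist_adj e_conn _ ecc').
rewrite -[r]coefK poly_def linear_sum summxE big1 // => i _.
rewrite linearZ rmorphXn /= horner_mx_X mxE powA ?mulr0 //.
exact: leq_trans (ltn_ord i) le_r.
Qed.

Lemma adjacency_mul_ones : A *m const_mx 1 = k%:R *: const_mx 1 :> 'cV_n.+1.
Proof.
apply/colP => a; rewrite !mxE mulr1 -(e_reg (ev a)) -sum1_card natr_sum.
rewrite [RHS](reindex ev) /=; last exact: onW_bij.
rewrite [RHS]big_mkcond /=; apply: eq_bigr => b _; rewrite !mxE inE mulr1.
by case: (e _ _).
Qed.

Lemma trmx_adjacency : A^T = A.
Proof. by apply/matrixP => a b; rewrite !mxE e_sym. Qed.

Section Spectrum.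

Variable d : nat.
Hypothesis e_eig : num_distinct_eigenvalues A d.+1.

Lemma size_mxminpoly_adjacency : size (mxminpoly A) = d.+2.
Proof.
apply: size_mxminpoly_symmetric e_eig.
  apply/is_hermitianmxP; rewrite expr0 scale1r map_mx_id //.
  by rewrite trmx_adjacency.
by apply/mxOverP => a b; rewrite mxE realn.
Qed.

Lemma horner_mx_small_eq0 (r : {poly C}) :
  (size r <= d.+1)%N -> horner_mx A r = 0 -> r = 0.
Proof.
move=> sz_r /mxminpoly_min A_r; apply: contraTeq sz_r => r_neq0.
by rewrite -ltnNge -size_mxminpoly_adjacency dvdp_leq.
Qed.

(** For q the quotient of the minimal polynomial by X - k, the equations
    A q(A) = q(A) A = k q(A) make the columns and rows of q(A) harmonic, hence
    constant. The constant is not 0 by minimality, and q is scaled by its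
    inverse. *)
Lemma hoffman_polynomial :
  exists2 q : {poly C}, size q = d.+1 & horner_mx A q = const_mx 1.
Proof.
have [v Av v_neq0] : exists2 v : 'rV_n.+1, v *m A = k%:R *: v & v != 0.
  exists (const_mx 1).
    rewrite -{1}trmx_adjacency -trmx_const -trmx_mul adjacency_mul_ones.
    by rewrite linearZ.
  by apply/eqP => /rowP/(_ 0)/eqP; rewrite !mxE oner_eq0.
have k_eig : eigenvalue A k%:R by apply/eigenvalueP; exists v.
rewrite eigenvalue_root_min in k_eig; have /factor_theorem[q qE] := k_eig.
have min_neq0 : mxminpoly A != 0
  by rewrite -size_poly_eq0 size_mxminpoly_adjacency.
have q_neq0 : q != 0 by apply: contraNneq min_neq0 => q0; rewrite qE q0 mul0r.
have sz_q : size q = d.+1.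
  have := size_mxminpoly_adjacency.
  by rewrite qE size_Mmonic ?monicXsubC // size_XsubC addn2 => -[].
have Aq : A *m horner_mx A q = k%:R *: horner_mx A q.
  have : horner_mx A (('X - k%:R%:P) * q) = 0
    by rewrite mulrC -qE mx_root_minpoly.
  rewrite rmorphM rmorphB /= horner_mx_X horner_mx_C [_ * _]mulmxBl.
  by rewrite mul_scalar_mx => /eqP; rewrite subr_eq0 => /eqP.
have qA : horner_mx A q *m A = k%:R *: horner_mx A q.
  by rewrite -Aq; apply: comm_horner_mx.
have [rk evK rkK] := ev_bij.
have sum_nbr (h : T -> C) x :
    \sum_(y | e x y) h y = \sum_b A (rk x) b * h (ev b).
  rewrite (reindex ev) /=; last exact: onW_bij.
  rewrite big_mkcond; apply: eq_bigr => b _; rewrite !mxE rkK.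
  by case: (e _ _); rewrite ?mul1r ?mul0r.
have row_const a b a' : horner_mx A q a b = horner_mx A q a' b.
  have := @harmonic_constant C T e k (fun x => horner_mx A q (rk x) b).
  move=> /(_ e_sym e_conn e_reg) hc; rewrite -[a]evK -[a']evK; apply: hc => x.
  rewrite sum_nbr; under eq_bigr => c _ do rewrite evK.
  by have /matrixP/(_ (rk x) b) := Aq; rewrite !mxE.
have col_const a b b' : horner_mx A q a b = horner_mx A q a b'.
  have := @harmonic_constant C T e k (fun x => horner_mx A q a (rk x)).
  move=> /(_ e_sym e_conn e_reg) hc; rewrite -[b]evK -[b']evK; apply: hc => x.
  rewrite sum_nbr; under eq_bigr => c _ do rewrite evK mulrC.
  have /matrixP/(_ a (rk x)) := qA; rewrite !mxE => <-.
  by apply: eq_bigr => c _; rewrite !mxE e_sym.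
have qJ : horner_mx A q = const_mx (horner_mx A q 0 0).
  by apply/matrixP => a b; rewrite !mxE (row_const _ _ 0) (col_const _ _ 0).
have c_neq0 : horner_mx A q 0 0 != 0.
  apply: contra q_neq0 => /eqP c0; apply/eqP/horner_mx_small_eq0.
    by rewrite sz_q.
  by rewrite qJ c0; apply/matrixP => a b; rewrite !mxE.
exists ((horner_mx A q 0 0)^-1 *: q); first by rewrite size_scale ?invr_eq0.
rewrite linearZ /= {2}qJ; apply/matrixP => a b.
by rewrite !mxE mulVf.
Qed.

Lemma dist_le_spectrum x y : (dist x y <= d)%N.
Proof.
have [q sz_q qJ] := hoffman_polynomial; have [rk evK rkK] := ev_bij.
rewrite leqNgt; apply/negP => far; have := @horner_mx_far q (rk x) (rk y).
rewrite !rkK sz_q qJ mxE => /(_ far) /eqP.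
by rewrite oner_eq0.
Qed.

Section Girth.

Hypothesis long_cycles :
  forall c, is_graph_cycle e c -> (2 * d - 1 <= size c)%N.

(** The polynomials obey p_(i+2) = X p_(i+1) - (k - [i > 0]) p_i, with p_0 = 1
    and p_1 = X. *)
Lemma distance_poly_lt i : (i < d)%N ->
  exists2 p : {poly C}, size p = i.+1 & horner_mx A p = distance_mx i.
Proof.
elim/ltn_ind: i => -[|[|i]] IHi lt_i.
- exists 1; rewrite ?size_poly1 // rmorph1; apply/matrixP => a b.
  by rewrite !mxE dist_eq0 // (bij_eq ev_bij).
- exists 'X; rewrite ?size_polyX // horner_mx_X; apply/matrixP => a b.
  by rewrite !mxE dist_eq1.
have [p1 sz1 p1E] := IHi i.+1 (ltnSn _) (ltnW lt_i).
have [p0 sz0 p0E] := IHi i (leqnSn _) (ltnW (ltnW lt_i)).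
exists ('X * p1 - (k - (0 < i))%:R *: p0).
  have p1_neq0 : p1 != 0 by rewrite -size_poly_eq0 sz1.
  have szX : size ('X * p1) = i.+3 by rewrite mulrC size_mulX // sz1.
  rewrite size_polyDl szX // size_polyN.
  by apply: leq_ltn_trans (size_scale_leq _ _) _; rewrite sz0; lia.
rewrite rmorphB rmorphM /= horner_mx_X linearZ /= p1E p0E.
apply/eqP; rewrite subr_eq [_ * _]relation_mx_mul; apply/eqP/matrixP => a b.
rewrite !mxE (card_neighbors_at_dist e_irr e_sym e_conn long_cycles _ _ e_reg).
  by rewrite natrD natrM.
by lia.
Qed.

(** The girth gives no control on A_d, but no distance exceeds d, so that A_d is
    the difference between J and the sum of the A_i with i < d. *)
Lemma distance_poly i : (i <= d)%N ->
  exists2 p : {poly C}, size p = i.+1 & horner_mx A p = distance_mx i.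
Proof.
rewrite leq_eqVlt => /predU1P[-> {i}|]; last exact: distance_poly_lt.
have [q sz_q qJ] := hoffman_polynomial.
have [r sz_r rE] : exists2 r : {poly C}, (size r <= d)%N &
    horner_mx A r = \sum_(i < d) distance_mx i.
  have : forall m, (m <= d)%N -> exists2 r : {poly C}, (size r <= m)%N &
      horner_mx A r = \sum_(i < m) distance_mx i.
    elim=> [|m IHm] lt_m.
      by exists 0; rewrite ?size_poly0 // big_ord0 rmorph0.
    have [|r sz_r rE] := IHm; first exact: ltnW.
    have [p sz_p pE] := distance_poly_lt lt_m.
    exists (r + p); last by rewrite rmorphD /= rE pE big_ord_recr.
    by rewrite (leq_trans (size_polyD _ _)) // sz_p geq_max leqnn andbT ltnW.
  by move=> /(_ d (leqnn d)).
exists (q - r); first by rewrite size_polyDl sz_q // size_polyN.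
rewrite rmorphB /= qJ rE; apply/eqP; rewrite subr_eq; apply/eqP.
rewrite addrC -(big_ord_recr d (fun i => distance_mx i)) /=.
apply/matrixP => a b; rewrite summxE mxE.
pose l := Ordinal (dist_le_spectrum (ev a) (ev b) : _ < d.+1)%N.
rewrite (bigD1 l) //= mxE eqxx big1 ?addr0 // => i; rewrite mxE.
by rewrite -val_eqE /= eq_sym => /negPf->.
Qed.

(** Otherwise A_d, a polynomial of degree d in A, would be zero. *)
Lemma ex_distance_eq : exists x y, dist x y = d.
Proof.
have [p sz_p pE] := distance_poly (leqnn d).
suff [a [b /eqP dab]] : exists a b, dist (ev a) (ev b) == d
  by exists (ev a), (ev b).
have : distance_mx d != 0.
  rewrite -pE; apply/eqP => /horner_mx_small_eq0.
  by rewrite sz_p => /(_ (leqnn _)) p0; rewrite p0 size_poly0 in sz_p.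
case: (pickP (fun u => dist (ev u.1) (ev u.2) == d)) => [[a b] dab _|none].
  by exists a, b.
case/eqP; apply/matrixP => a b; rewrite !mxE.
by have /= -> := none (a, b).
Qed.

(** The polynomials whose values at A are A_0, ..., A_d have degrees 0, ..., d,
    so they span all remainders modulo the minimal polynomial of A. *)
Lemma horner_mx_dist (r : {poly C}) a b a' b' :
    dist (ev a) (ev b) = dist (ev a') (ev b') ->
  horner_mx A r a b = horner_mx A r a' b'.
Proof.
move=> same_dist.
have small m (s : {poly C}) : (size s <= m)%N -> (m <= d.+1)%N ->
    horner_mx A s a b = horner_mx A s a' b'.
  elim: m s => [|m IHm] s sz_s lt_m.
    by move: sz_s; rewrite size_poly_leq0 => /eqP->; rewrite rmorph0 !mxE.
  have [p sz_p pE] := distance_poly lt_m.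
  have p_lead : p`_m != 0.
    rewrite -[m]/(m.+1.-1) -sz_p -lead_coefE lead_coef_eq0.
    by rewrite -size_poly_eq0 sz_p.
  pose s' := s - (s`_m / p`_m) *: p.
  have -> : s = s' + (s`_m / p`_m) *: p by rewrite subrK.
  rewrite rmorphD /= linearZ /= pE !mxE same_dist; congr (_ + _).
  apply: IHm; last exact: ltnW.
  apply/leq_sizeP => j; rewrite leq_eqVlt => /predU1P[<-|lt_mj].
    by rewrite coefB coefZ divfK // subrr.
  have sj0 : s`_j = 0 by apply/nth_default/(leq_trans sz_s).
  by rewrite coefB coefZ sj0 [p`_j]nth_default ?sz_p // mulr0 subrr.
rewrite (divp_eq r (mxminpoly A)) rmorphD rmorphM /= mx_root_minpoly mulr0 add0r.
apply: (small d.+1) => //; rewrite -ltnS -size_mxminpoly_adjacency ltn_modp.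
by rewrite -size_poly_eq0 size_mxminpoly_adjacency.
Qed.

Lemma card_dist_eq i j x y x' y' : dist x y = dist x' y' ->
  #|[set z | (dist x z == i) && (dist z y == j)]|
    = #|[set z | (dist x' z == i) && (dist z y' == j)]|.
Proof.
have [rk evK rkK] := ev_bij.
rewrite -[x]rkK -[y]rkK -[x']rkK -[y']rkK => same_dist.
have ex_poly l : exists p : {poly C}, horner_mx A p = distance_mx l.
  have [/distance_poly[p _ pE]|lt_dl] := leqP l d; first by exists p.
  exists 0; rewrite rmorph0; apply/matrixP => a b; rewrite !mxE.
  by rewrite ltn_eqF // (leq_ltn_trans _ lt_dl) ?dist_le_spectrum.
have [[p pE] [q qE]] := (ex_poly i, ex_poly j).
have := @horner_mx_dist (p * q) _ _ _ _ same_dist.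
rewrite rmorphM /= pE qE [_ * _]relation_mx_mul !mxE => /eqP.
by rewrite eqr_nat => /eqP.
Qed.

End Girth.
End Spectrum.
End AdjacencyAlgebra.

(** * Distance-regularity *)

Theorem theorem6 (C : numClosedFieldType) (T : finType) (e : rel T)
    (k d : nat) (g : option nat)
    (e_irr : irreflexive e) (e_sym : symmetric e)
    (e_conn : connected_graph e) (e_reg : regular_graph e k)
    (e_girth : is_girth e g)
    (e_eig : num_distinct_eigenvalues (adjacency e C) d.+1)
    (g_ge : girth_geq g (2 * d - 1)) :
  distance_regular e /\ diameter e = d.
Proof.
have [T_gt0 conn] := e_conn.
have long_cycles c : is_graph_cycle e c -> (2 * d - 1 <= size c)%N.
  case: g e_girth g_ge => [m [_ min_m] /leq_trans le_m /min_m/le_m //|acyclic _].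
  by rewrite (negPf (acyclic c)).
have [n [ev [ev_bij eig]]] : exists n, exists ev : 'I_n.+1 -> T,
    bijective ev /\ num_distinct_eigenvalues (relation_mx C ev e) d.+1.
  move: e_eig (@enum_val_bij T) T_gt0; rewrite /adjacency.
  move: (@enum_val T T); case: #|T| => // n ev eig ev_bij _.
  by exists n, ev.
have card_eq := card_dist_eq ev_bij e_irr e_sym conn e_reg eig long_cycles.
split.
  split=> //; exists (fun i j l =>
    if [pick u : T * T | dist e u.1 u.2 == l] is Some u
    then #|[set z | (dist e u.1 z == i) && (dist e z u.2 == j)]| else 0%N).
  move=> i j l x y dxy; case: pickP => [u /eqP du|/(_ (x, y))].
    by apply: card_eq; rewrite dxy du.
  by rewrite /= dxy eqxx.
apply/eqP; rewrite eqn_leq; apply/andP; split.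
  apply/bigmax_leqP => u _.
  exact: (dist_le_spectrum ev_bij e_sym conn e_reg eig).
have [x [y <-]] := ex_distance_eq ev_bij e_irr e_sym conn e_reg eig long_cycles.
exact: (leq_bigmax (x, y)).
Qed.
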